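(* Let $\mathcal H$ be a hypergraph on a finite set $V$. For $M\subseteq V$ and $S=V\setminus M$, $$M\models\Phi_{\mathcal H}\quad\Longleftrightarrow\quad S\in\operatorname{Stop}(\mathcal H).$$ Hence complementation is an order-reversing bijection from $\operatorname{Mod}(\Phi_{\mathcal H})$ onto $\operatorname{Stop}(\mathcal H)$, and $$\operatorname{MinStop}(\mathcal H)=\{V\setminus M: M\in\mathcal M(\Phi_{\mathcal H})\}.$$
   Context: A hypergraph on a finite set $V$ is a family $\mathcal H\subseteq 2^V$. The associated definite Horn CNF is $\Phi_{\mathcal H}=\bigwedge_{A\in\mathcal H}\bigwedge_{v\in A}((A\setminus\{v\})\to v)$. An assignment is identified with the set $M\subseteq V$ of true variables; $M$ satisfies $B\to v$ if $B\subseteq M$ implies $v\in M$. $\operatorname{Mod}(\Phi_{\mathcal H})$ is the family of models, and $\mathcal M(\Phi_{\mathcal H})$ is the family of coatoms, i.e. the inclusion-maximal members of $\operatorname{Mod}(\Phi_{\mathcal H})\setminus\{V\}$. A stopping set is a set $S\subseteq V$ with $|A\cap S|\neq1$ for every $A\in\mathcal H$; $\operatorname{Stop}(\mathcal H)$ is the family of all stopping sets, and $\operatorname{MinStop}(\mathcal H)$ is the family of inclusion-minimal members of $\operatorname{Stop}(\mathcal H)\setminus\{\varnothing\}$. *)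

(* Defs.v *)
From mathcomp Require Import all_boot.

Set Implicit Arguments.
Unset Strict Implicit.
Unset Printing Implicit Defensive.

Section Defs.
Variable V : finType.

Definition hypergraph := {set {set V}}.

(* The pair (B, v) stands for the definite Horn clause B -> v; a CNF is the
   finite set of its clauses, read conjunctively. *)
Definition clause := ({set V} * V)%type.
Definition hornCNF := {set clause}.

(* An assignment is the set M of its true variables. *)
Definition sat_clause (M : {set V}) (c : clause) : bool :=
  (c.1 \subset M) ==> (c.2 \in M).

Definition satisfies (M : {set V}) (Phi : hornCNF) : bool :=
  [forall c in Phi, sat_clause M c].

Definition Mod (Phi : hornCNF) : {set {set V}} :=
  [set M | satisfies M Phi].

Definition coatoms (Phi : hornCNF) : {set {set V}} :=
  [set M | maxset [in Mod Phi :\ [set: V]] M].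

Definition hyperCNF (H : hypergraph) : hornCNF :=
  \bigcup_(A in H) [set (A :\ v, v) | v in A].

Definition stopping_set (H : hypergraph) (S : {set V}) : bool :=
  [forall A in H, #|A :&: S| != 1].

Definition Stop (H : hypergraph) : {set {set V}} :=
  [set S | stopping_set H S].

Definition MinStop (H : hypergraph) : {set {set V}} :=
  [set S | minset [in Stop H :\ set0] S].

End Defs.

(* Main.v *)
Require Import Defs.
From mathcomp Require Import all_boot.

(** For [v] in an edge [A], an assignment [M] falsifies the clause
    [A \ {v} -> v] when the elements of [A] outside [M] are [v] and nothing
    else, that is, when [A] meets the complement of [M] exactly in [{v}].  So
    [M] falsifies one of the clauses coming from [A] if and only if the
    complement of [M] meets [A] in exactly one point, which is the situation
    forbidden for stopping sets ([satisfies_hyperCNF]).  Complementation is an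
    inclusion-reversing involution of the power set that exchanges [V] and the
    empty set, so it carries models to stopping sets, and the maximal ones
    among the models other than [V] to the minimal ones among the nonempty
    stopping sets ([minStop_setC]). *)

Section StoppingSets.
Variable V : finType.
Implicit Types (A M S : {set V}) (H : hypergraph V).

Lemma sat_clause_edge A M v : v \in A ->
  sat_clause M (A :\ v, v) = (A :&: ~: M != [set v]).
Proof.
move=> vA; rewrite /sat_clause /= implybE -[v \in M]negbK -negb_and; congr (~~ _).
(* The inclusion [A :\ v \subset M] bounds the trace of [A] on [~: M] by [v];
   the condition [v \notin M] is the converse bound. *)
by rewrite eqEsubset sub1set in_setI in_setC vA -setDE subDset setUC -subDset.
Qed.

Lemma satisfies_hyperCNFP H M :
  reflect {in H, forall A, {in A, forall v, sat_clause M (A :\ v, v)}}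
          (satisfies M (hyperCNF H)).
Proof.
apply: (iffP forall_inP) => [sat A AH v vA | sat c].
  by apply: sat; apply/bigcupP; exists A => //; apply: imset_f.
by case/bigcupP=> A AH /imsetP[v vA ->]; apply: sat.
Qed.

(** A one-point trace of an edge [A] on [~: M] determines the head [v] of the
    clause that fails, which is how a condition on all clauses of [A] becomes
    a condition on a single cardinality. *)
Lemma satisfies_hyperCNF H M :
  satisfies M (hyperCNF H) = stopping_set H (~: M).
Proof.
apply/satisfies_hyperCNFP/forall_inP => [sat A AH | stop A AH v vA].
  apply/cards1P=> -[v Av].
  have vA: v \in A by have := set11 v; rewrite -Av => /setIP[].
  by have := sat A AH v vA; rewrite sat_clause_edge // Av eqxx.
rewrite sat_clause_edge //; apply: contra (stop A AH) => /eqP->.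
by rewrite cards1.
Qed.

(** Minimality of [~: M] for a property is maximality of [M] for the
    complemented property, and deleting [set0] from the stopping sets
    corresponds to deleting [V] from the models. *)
Lemma minStop_setC H M :
  (~: M \in MinStop H) = (M \in coatoms (hyperCNF H)).
Proof.
rewrite !inE minmaxset setCK; apply: maxset_eq => B.
by rewrite !inE satisfies_hyperCNF -setCT (inj_eq (@setC_inj V)).
Qed.

End StoppingSets.

Theorem proposition2p2 (V : finType) (H : hypergraph V) :
  (forall M S : {set V}, S = [set: V] :\: M ->
     (satisfies M (hyperCNF H) <-> S \in Stop H)) /\
  (let compl := fun M : {set V} => [set: V] :\: M in
   [/\ {in Mod (hyperCNF H) &, injective compl},
       compl @: Mod (hyperCNF H) = Stop H
     & {in Mod (hyperCNF H) &, forall M1 M2 : {set V},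
          (M1 \subset M2) <-> (compl M2 \subset compl M1)}]) /\
  MinStop H = [set [set: V] :\: M | M in coatoms (hyperCNF H)].
Proof.
have setTD_K (S : {set V}) : S = [set: V] :\: ~: S by rewrite setTD setCK.
split=> [M S -> | ]; first by rewrite setTD inE satisfies_hyperCNF.
split=> [compl | ]; first split.
- by move=> M1 M2 _ _; rewrite /compl !setTD; apply: setC_inj.
- apply/setP=> S; apply/imsetP/idP=> [[M modM ->] | stopS].
    by move: modM; rewrite /compl setTD !inE satisfies_hyperCNF.
  exists (~: S); last exact: setTD_K.
  by move: stopS; rewrite !inE satisfies_hyperCNF setCK.
- by move=> M1 M2 _ _; rewrite /compl !setTD setCS.
apply/setP=> S; apply/idP/imsetP=> [minS | [M coM ->]].
  by exists (~: S); rewrite -?minStop_setC ?setCK //; apply: setTD_K.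
by rewrite setTD minStop_setC.
Qed.
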